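(* A symmetric monoidal category $C$ is equivalent, as an object of the 2-category $\mathrm{SymmMonCat}$, to a prop if and only if there is an object $x\in C$ such that every object of $C$ is isomorphic to the $n$th tensor power $x^{\otimes n}=x\otimes(x\otimes(x\otimes\cdots))$ of $x$ for some $n\in\mathbb{N}$.
   Context: A prop is a strict symmetric monoidal category whose objects are the natural numbers, with tensor product of objects given by addition. $\mathrm{SymmMonCat}$ is the 2-category whose objects are symmetric monoidal categories, whose morphisms are symmetric monoidal functors, and whose 2-morphisms are monoidal natural transformations; here the notions are the weak ones (laws hold up to coherent natural isomorphism; functors are strong). Thus $C$ is equivalent to a prop $T$ when there are symmetric monoidal functors $j\colon T\to C$, $k\colon C\to T$ and monoidal natural isomorphisms $jk\cong 1_C$, $kj\cong 1_T$. *)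

(* Defs.v *)
From mathcomp Require Import all_boot.

Set Implicit Arguments.
Unset Strict Implicit.
Unset Printing Implicit Defensive.

Declare Scope cat_scope.
Delimit Scope cat_scope with cat.
Local Open Scope cat_scope.

(* Structures are parametrized by their type of objects, so that "the objects
   are the natural numbers" can be said by taking that type to be [nat].  *)
Record category (ob : Type) := Category {
  hom : ob -> ob -> Type;
  idm : forall a, hom a a;
  comp : forall a b c, hom b c -> hom a b -> hom a c;
  comp1m : forall a b (f : hom a b), comp (idm b) f = f;
  compm1 : forall a b (f : hom a b), comp f (idm a) = f;
  compA : forall a b c d (h : hom c d) (g : hom b c) (f : hom a b),
    comp h (comp g f) = comp (comp h g) f
}.
Arguments hom {ob} C a b : rename.
Arguments idm {ob} C a : rename.
Arguments comp {ob C a b c} g f : rename.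
Arguments comp1m {ob C a b} f : rename.
Arguments compm1 {ob C a b} f : rename.
Arguments compA {ob C a b c d} h g f : rename.

Notation "g ∘ f" := (comp g f) (at level 40, left associativity) : cat_scope.

Record iso (ob : Type) (C : category ob) (a b : ob) := Iso {
  iso_hom :> hom C a b;
  iso_inv : hom C b a;
  iso_invK : iso_inv ∘ iso_hom = idm C a;
  iso_homK : iso_hom ∘ iso_inv = idm C b
}.
Arguments iso {ob} C a b.
Arguments Iso {ob C a b} iso_hom iso_inv iso_invK iso_homK.
Arguments iso_inv {ob C a b} i : rename.

Definition isomorphic (ob : Type) (C : category ob) (a b : ob) : Prop :=
  inhabited (iso C a b).

Definition eq_hom (ob : Type) (C : category ob) (a b : ob) (e : a = b) :
    hom C a b :=
  match e in _ = y return hom C a y with erefl => idm C a end.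

Record symMonCat (ob : Type) := SymMonCat {
  smc_cat :> category ob;
  tens : ob -> ob -> ob;
  tensm : forall a b a' b', hom smc_cat a a' -> hom smc_cat b b' ->
    hom smc_cat (tens a b) (tens a' b');
  tunit : ob;
  tensm1 : forall a b,
    tensm (idm smc_cat a) (idm smc_cat b) = idm smc_cat (tens a b);
  tensm_comp : forall a b a' b' a'' b''
      (f' : hom smc_cat a' a'') (f : hom smc_cat a a')
      (g' : hom smc_cat b' b'') (g : hom smc_cat b b'),
    tensm (f' ∘ f) (g' ∘ g) = tensm f' g' ∘ tensm f g;
  assoc : forall a b c,
    iso smc_cat (tens (tens a b) c) (tens a (tens b c));
  assoc_nat : forall a b c a' b' c' (f : hom smc_cat a a')
      (g : hom smc_cat b b') (h : hom smc_cat c c'),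
    assoc a' b' c' ∘ tensm (tensm f g) h
    = tensm f (tensm g h) ∘ assoc a b c;
  lunit : forall a, iso smc_cat (tens tunit a) a;
  lunit_nat : forall a a' (f : hom smc_cat a a'),
    lunit a' ∘ tensm (idm smc_cat tunit) f = f ∘ lunit a;
  runit : forall a, iso smc_cat (tens a tunit) a;
  runit_nat : forall a a' (f : hom smc_cat a a'),
    runit a' ∘ tensm f (idm smc_cat tunit) = f ∘ runit a;
  braid : forall a b, iso smc_cat (tens a b) (tens b a);
  braid_nat : forall a b a' b' (f : hom smc_cat a a') (g : hom smc_cat b b'),
    braid a' b' ∘ tensm f g = tensm g f ∘ braid a b;
  pentagon : forall a b c d,
    assoc a b (tens c d) ∘ assoc (tens a b) c d
    = tensm (idm smc_cat a) (assoc b c d) ∘ assoc a (tens b c) d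
      ∘ tensm (assoc a b c) (idm smc_cat d);
  triangle : forall a b,
    tensm (idm smc_cat a) (lunit b) ∘ assoc a tunit b
    = tensm (runit a) (idm smc_cat b);
  hexagon : forall a b c,
    assoc b c a ∘ braid a (tens b c) ∘ assoc a b c
    = tensm (idm smc_cat b) (braid a c) ∘ assoc b a c
      ∘ tensm (braid a b) (idm smc_cat c);
  braidK : forall a b, braid b a ∘ braid a b = idm smc_cat (tens a b)
}.
Arguments tens {ob} C a b : rename.
Arguments tensm {ob C a b a' b'} f g : rename.
Arguments tunit {ob} C : rename.
Arguments assoc {ob} C a b c : rename.
Arguments lunit {ob} C a : rename.
Arguments runit {ob} C a : rename.
Arguments braid {ob} C a b : rename.

Notation "f ⊗ g" := (tensm f g) (at level 38, left associativity) : cat_scope.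

(* Right-nested: [x^0] is the unit, [x^1] is [x] and [x^(n+2)] is
   [x ⊗ x^(n+1)], without a trailing unit factor.  *)
Definition tpow (ob : Type) (C : symMonCat ob) (x : ob) (n : nat) : ob :=
  iterop n (tens C) x (tunit C).

(* The associator and unitors are identities; the symmetry need not be.  *)
Definition strict (ob : Type) (C : symMonCat ob) : Prop :=
  [/\ exists eA : forall a b c,
        tens C (tens C a b) c = tens C a (tens C b c),
        forall a b c, iso_hom (assoc C a b c) = eq_hom C (eA a b c),
      exists eL : forall a, tens C (tunit C) a = a,
        forall a, iso_hom (lunit C a) = eq_hom C (eL a)
    & exists eR : forall a, tens C a (tunit C) = a,
        forall a, iso_hom (runit C a) = eq_hom C (eR a)].

(* [tunit] is necessarily [0], by strictness.  *)
Record PROP := MkPROP {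
  prop_smc :> symMonCat nat;
  prop_strict : strict prop_smc;
  prop_tens : forall m n, tens prop_smc m n = m + n
}.

Record functor (obC obD : Type) (C : category obC) (D : category obD) :=
    Functor {
  fob :> obC -> obD;
  fmap : forall a b, hom C a b -> hom D (fob a) (fob b);
  fmap1 : forall a, fmap (idm C a) = idm D (fob a);
  fmap_comp : forall a b c (g : hom C b c) (f : hom C a b),
    fmap (g ∘ f) = fmap g ∘ fmap f
}.
Arguments fmap {obC obD C D} F {a b} f : rename.

(* Strong: the structure maps [fmu] and [feps] are isomorphisms.  *)
Record symMonFunctor (obC obD : Type) (C : symMonCat obC) (D : symMonCat obD)
    := SymMonFunctor {
  smf_functor :> functor C D;
  fmu : forall a b,
    iso D (tens D (smf_functor a) (smf_functor b)) (smf_functor (tens C a b));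
  feps : iso D (tunit D) (smf_functor (tunit C));
  fmu_nat : forall a b a' b' (f : hom C a a') (g : hom C b b'),
    fmu a' b' ∘ (fmap smf_functor f ⊗ fmap smf_functor g)
    = fmap smf_functor (f ⊗ g) ∘ fmu a b;
  fmu_assoc : forall a b c,
    fmap smf_functor (assoc C a b c) ∘ fmu (tens C a b) c
      ∘ (fmu a b ⊗ idm D (smf_functor c))
    = fmu a (tens C b c) ∘ (idm D (smf_functor a) ⊗ fmu b c)
      ∘ assoc D (smf_functor a) (smf_functor b) (smf_functor c);
  fmu_lunit : forall a,
    fmap smf_functor (lunit C a) ∘ fmu (tunit C) a
      ∘ (feps ⊗ idm D (smf_functor a))
    = lunit D (smf_functor a);
  fmu_runit : forall a,
    fmap smf_functor (runit C a) ∘ fmu a (tunit C)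
      ∘ (idm D (smf_functor a) ⊗ feps)
    = runit D (smf_functor a);
  fmu_braid : forall a b,
    fmap smf_functor (braid C a b) ∘ fmu a b
    = fmu b a ∘ braid D (smf_functor a) (smf_functor b)
}.
Arguments fmu {obC obD C D} F a b : rename.
Arguments feps {obC obD C D} F : rename.

Record monNatTrans (obC obD : Type) (C : symMonCat obC) (D : symMonCat obD)
    (F G : symMonFunctor C D) := MonNatTrans {
  mnt :> forall a, hom D (F a) (G a);
  mnt_nat : forall a b (f : hom C a b), mnt b ∘ fmap F f = fmap G f ∘ mnt a;
  mnt_mu : forall a b,
    mnt (tens C a b) ∘ fmu F a b = fmu G a b ∘ (mnt a ⊗ mnt b);
  mnt_eps : mnt (tunit C) ∘ feps F = feps G
}.

Definition monNatIsomorphic (obC obD : Type) (C : symMonCat obC)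
    (D : symMonCat obD) (F G : symMonFunctor C D) : Prop :=
  exists (s : monNatTrans F G) (t : monNatTrans G F),
    (forall a, t a ∘ s a = idm D (F a)) /\
    (forall a, s a ∘ t a = idm D (G a)).

Section IsoConstructions.
Variables (obC obD : Type) (C : category obC) (D : category obD).

Definition id_iso (a : obC) : iso C a a :=
  Iso (idm C a) (idm C a) (comp1m _) (comp1m _).

Lemma comp_iso_invK (a b c : obC) (g : iso C b c) (f : iso C a b) :
  (iso_inv f ∘ iso_inv g) ∘ (g ∘ f) = idm C a.
Proof. by rewrite compA -(compA _ _ g) iso_invK compm1 iso_invK. Qed.

Lemma comp_iso_homK (a b c : obC) (g : iso C b c) (f : iso C a b) :
  (g ∘ f) ∘ (iso_inv f ∘ iso_inv g) = idm C c.
Proof. by rewrite compA -(compA _ f) iso_homK compm1 iso_homK. Qed.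

Definition comp_iso (a b c : obC) (g : iso C b c) (f : iso C a b) : iso C a c :=
  Iso _ _ (comp_iso_invK g f) (comp_iso_homK g f).

Lemma fmap_iso_invK (F : functor C D) (a b : obC) (f : iso C a b) :
  fmap F (iso_inv f) ∘ fmap F f = idm D (F a).
Proof. by rewrite -fmap_comp iso_invK fmap1. Qed.

Lemma fmap_iso_homK (F : functor C D) (a b : obC) (f : iso C a b) :
  fmap F f ∘ fmap F (iso_inv f) = idm D (F b).
Proof. by rewrite -fmap_comp iso_homK fmap1. Qed.

Definition fmap_iso (F : functor C D) (a b : obC) (f : iso C a b) :
    iso D (F a) (F b) :=
  Iso _ _ (fmap_iso_invK F f) (fmap_iso_homK F f).

End IsoConstructions.

Section IdentityFunctor.
Variables (obC : Type) (C : symMonCat obC).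

Definition id_functor : functor C C :=
  @Functor _ _ C C id (fun _ _ f => f) (fun _ => erefl) (fun _ _ _ _ _ => erefl).

Definition id_smf : symMonFunctor C C.
Proof.
refine (@SymMonFunctor _ _ C C id_functor (fun a b => id_iso C (tens C a b))
  (id_iso C (tunit C)) _ _ _ _ _) => * /=;
  by rewrite ?tensm1 ?comp1m ?compm1 ?comp1m.
Defined.

End IdentityFunctor.

Section Composition.
Variables (obC obD obE : Type).
Variables (C : symMonCat obC) (D : symMonCat obD) (E : symMonCat obE).
Variables (G : symMonFunctor D E) (F : symMonFunctor C D).

Definition comp_functor : functor C E.
Proof.
refine (@Functor _ _ C E (fun a => G (F a)) (fun a b f => fmap G (fmap F f)) _ _).
- by move=> a; rewrite !fmap1.
- by move=> *; rewrite !fmap_comp.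
Defined.

Definition comp_mu (a b : obC) :
    iso E (tens E (comp_functor a) (comp_functor b))
          (comp_functor (tens C a b)) :=
  comp_iso (fmap_iso G (fmu F a b)) (fmu G (F a) (F b)).

Definition comp_eps : iso E (tunit E) (comp_functor (tunit C)) :=
  comp_iso (fmap_iso G (feps F)) (feps G).

Lemma tensm_compl (a a' a'' b : obE) (f' : hom E a' a'') (f : hom E a a') :
  (f' ∘ f) ⊗ idm E b = (f' ⊗ idm E b) ∘ (f ⊗ idm E b).
Proof. by rewrite -tensm_comp comp1m. Qed.

Lemma tensm_compr (a b b' b'' : obE) (f' : hom E b' b'') (f : hom E b b') :
  idm E a ⊗ (f' ∘ f) = (idm E a ⊗ f') ∘ (idm E a ⊗ f).
Proof. by rewrite -tensm_comp comp1m. Qed.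

Lemma fmu_natl (a a' b : obD) (f : hom D a a') :
  fmu G a' b ∘ (fmap G f ⊗ idm E (G b)) = fmap G (f ⊗ idm D b) ∘ fmu G a b.
Proof. by rewrite -fmu_nat fmap1. Qed.

Lemma fmu_natr (a b b' : obD) (f : hom D b b') :
  fmu G a b' ∘ (idm E (G a) ⊗ fmap G f) = fmap G (idm D a ⊗ f) ∘ fmu G a b.
Proof. by rewrite -fmu_nat fmap1. Qed.

Definition comp_smf : symMonFunctor C E.
Proof.
refine (@SymMonFunctor _ _ C E comp_functor comp_mu comp_eps _ _ _ _ _) => /=.
- move=> a b a' b' f g.
  by rewrite -compA fmu_nat !compA -!fmap_comp fmu_nat.
- move=> a b c; rewrite tensm_compl tensm_compr !compA.
  rewrite -(compA _ _ (fmap G (fmu F a b) ⊗ _)) fmu_natl !compA.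
  rewrite -!fmap_comp fmu_assoc.
  rewrite -(compA _ _ (_ ⊗ fmap G (fmu F b c))) fmu_natr !compA.
  by rewrite !fmap_comp -!compA; congr (_ ∘ (_ ∘ _)); rewrite !compA fmu_assoc.
- move=> a; rewrite tensm_compl !compA.
  rewrite -(compA _ _ (fmap G (feps F) ⊗ _)) fmu_natl !compA.
  by rewrite -!fmap_comp fmu_lunit fmu_lunit.
- move=> a; rewrite tensm_compr !compA.
  rewrite -(compA _ _ (_ ⊗ fmap G (feps F))) fmu_natr !compA.
  by rewrite -!fmap_comp fmu_runit fmu_runit.
- move=> a b; rewrite compA -fmap_comp fmu_braid fmap_comp -!compA.
  by rewrite fmu_braid.
Defined.

End Composition.

Definition smcEquivalent (obC obD : Type) (C : symMonCat obC)
    (D : symMonCat obD) : Prop :=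
  exists (j : symMonFunctor D C) (k : symMonFunctor C D),
    monNatIsomorphic (comp_smf j k) (id_smf C) /\
    monNatIsomorphic (comp_smf k j) (id_smf D).

(* Main.v *)
Require Import Defs.
From mathcomp Require Import all_boot.
From Stdlib Require Import ClassicalEpsilon.

(** If [C] is equivalent to a prop [T] through [j : T -> C], then the object
    [j 1] generates [C]: in [T] the object [n] is the [n]th tensor power of [1],
    strong functors preserve tensor powers up to isomorphism
    ([prop_image_tpow]), and essential surjectivity of [j] does the rest.

    Conversely, let [x] generate [C], and write [P n] for
    [x ⊗ (x ⊗ ... (x ⊗ I))], with [I] the unit.  Take the category on the
    natural numbers whose morphisms from [m] to [n] are the morphisms of [C]
    from [P m] to [P n].
    Associators and left unitors of [C] provide canonical isomorphisms
    [P m ⊗ P n -> P (m + n)] ([rpow_add]), and conjugating by them turns the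
    tensor product and the braiding of [C] into operations on that category.
    There is one way to make the canonical isomorphisms into the structure of a
    symmetric monoidal functor [P], and the axioms of [C] then yield those of
    the new category ([full_image_smc]).

    The point is that the result is strict.  Its associators and unitors are
    determined by compatibility with the canonical isomorphisms, so it is enough
    that the identity morphisms are compatible: this is the coherence statement
    made of [rpow_addA], [rpow_add0n] and [rpow_addn0], proved by induction on
    the first exponent from the pentagon and from Kelly's lemmas on unitors
    ([lunit_tens], [runit_tens], [lunit_unit]).  The braiding, in contrast, is
    only conjugated and stays non-trivial in general.

    Finally [P] is fully faithful by construction and essentially surjective
    because [x] generates, and a fully faithful, essentially surjective strong
    symmetric monoidal functor is an equivalence ([ff_eso_equivalent]): choose
    preimages of objects and transport the structure along the chosen
    isomorphisms. *)

Set Implicit Arguments.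
Unset Strict Implicit.
Unset Printing Implicit Defensive.
(* Lets [compA] denote associativity in a category, not that of functions. *)
Import Defs.
Local Open Scope cat_scope.

(** * Isomorphisms *)

Section Isomorphisms.
Variables (ob : Type) (C : category ob).

Definition inv_iso (a b : ob) (f : iso C a b) : iso C b a :=
  Iso (iso_inv f) f (iso_homK f) (iso_invK f).

Lemma iso_epi (a b c : ob) (f : iso C a b) (g h : hom C b c) :
  g ∘ f = h ∘ f -> g = h.
Proof.
by move=> /(congr1 (fun k => k ∘ iso_inv f)); rewrite -!compA iso_homK !compm1.
Qed.

Lemma iso_mono (a b c : ob) (f : iso C b c) (g h : hom C a b) :
  f ∘ g = f ∘ h -> g = h.
Proof.
by move=> /(congr1 (comp (iso_inv f))); rewrite !compA iso_invK !comp1m.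
Qed.

Lemma iso_homKr (a b c : ob) (f : iso C a b) (r : hom C c b) :
  f ∘ (iso_inv f ∘ r) = r.
Proof. by rewrite compA iso_homK comp1m. Qed.

Lemma isomorphic_sym (a b : ob) : isomorphic C a b -> isomorphic C b a.
Proof. by case=> f; constructor; exact: inv_iso. Qed.

Lemma isomorphic_trans (b a c : ob) :
  isomorphic C a b -> isomorphic C b c -> isomorphic C a c.
Proof. by case=> f [g]; constructor; exact: comp_iso g f. Qed.

Lemma isomorphic_eq (a b : ob) : a = b -> isomorphic C a b.
Proof. by move=> <-; constructor; exact: id_iso. Qed.

End Isomorphisms.

Section TensorOfIsos.
Variables (ob : Type) (C : symMonCat ob).

Lemma tensm_compr_assoc (a b a' b' a'' b'' d : ob)
    (f' : hom C a' a'') (f : hom C a a') (g' : hom C b' b'') (g : hom C b b')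
    (r : hom C d (tens C a b)) :
  (f' ⊗ g') ∘ ((f ⊗ g) ∘ r) = ((f' ∘ f) ⊗ (g' ∘ g)) ∘ r.
Proof. by rewrite compA -tensm_comp. Qed.

Lemma tens_exchange (a b a' b' d : ob) (f : hom C a a') (g : hom C b b')
    (r : hom C d (tens C a b)) :
  (idm C a' ⊗ g) ∘ ((f ⊗ idm C b) ∘ r) = (f ⊗ idm C b') ∘ ((idm C a ⊗ g) ∘ r).
Proof. by rewrite !tensm_compr_assoc !comp1m !compm1. Qed.

Lemma assoc_natr (a b c a' b' c' d : ob) (f : hom C a a')
    (g : hom C b b') (h : hom C c c') (r : hom C d _) :
  assoc C a' b' c' ∘ (((f ⊗ g) ⊗ h) ∘ r)
  = (f ⊗ (g ⊗ h)) ∘ (assoc C a b c ∘ r).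
Proof. by rewrite compA assoc_nat -compA. Qed.

Lemma tens_iso_invK (a b a' b' : ob) (f : iso C a a') (g : iso C b b') :
  (iso_inv f ⊗ iso_inv g) ∘ (f ⊗ g) = idm C (tens C a b).
Proof. by rewrite -tensm_comp !iso_invK tensm1. Qed.

Lemma tens_iso_homK (a b a' b' : ob) (f : iso C a a') (g : iso C b b') :
  (f ⊗ g) ∘ (iso_inv f ⊗ iso_inv g) = idm C (tens C a' b').
Proof. by rewrite -tensm_comp !iso_homK tensm1. Qed.

Definition tens_iso (a b a' b' : ob) (f : iso C a a') (g : iso C b b') :
    iso C (tens C a b) (tens C a' b') :=
  Iso _ _ (tens_iso_invK f g) (tens_iso_homK f g).

Lemma isomorphic_tens (a b a' b' : ob) :
  isomorphic C a a' -> isomorphic C b b' ->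
  isomorphic C (tens C a b) (tens C a' b').
Proof. by case=> f [g]; constructor; exact: tens_iso f g. Qed.

End TensorOfIsos.

(** * Coherence of the unit *)

Section UnitCoherence.
Variables (ob : Type) (C : symMonCat ob).

Lemma tens_unitl_faithful (a b : ob) (f g : hom C a b) :
  idm C (tunit C) ⊗ f = idm C (tunit C) ⊗ g -> f = g.
Proof.
by move=> e; apply: (@iso_epi _ _ _ _ _ (lunit C a)); rewrite -!lunit_nat e.
Qed.

Lemma tens_unitr_faithful (a b : ob) (f g : hom C a b) :
  f ⊗ idm C (tunit C) = g ⊗ idm C (tunit C) -> f = g.
Proof.
by move=> e; apply: (@iso_epi _ _ _ _ _ (runit C a)); rewrite -!runit_nat e.
Qed.

(** The first of Kelly's redundant axioms.  Tensored on the left with the unit,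
    it becomes one face of a pentagon whose other faces are two triangles and
    naturality squares; tensoring with the unit is faithful. *)
Lemma lunit_tens (a b : ob) :
  lunit C (tens C a b) ∘ assoc C (tunit C) a b = lunit C a ⊗ idm C b.
Proof.
apply: tens_unitl_faithful.
apply: (@iso_epi _ _ _ _ _ (assoc C _ (tens C (tunit C) a) b)).
apply: (@iso_epi _ _ _ _ _ (tens_iso (assoc C _ _ a) (id_iso C b))) => /=.
rewrite -assoc_nat -!compA -tensm_comp comp1m triangle.
rewrite -[idm C (tunit C)](comp1m (idm C _)) tensm_comp -compA.
rewrite [X in _ ∘ X]compA -pentagon compA triangle.
by rewrite assoc_nat tensm1.
Qed.

(** The mirror image of [lunit_tens], with the pentagon on [a], [b] and two
    copies of the unit. *)
Lemma runit_tens (a b : ob) :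
  (idm C a ⊗ runit C b) ∘ assoc C a b (tunit C) = runit C (tens C a b).
Proof.
apply: tens_unitr_faithful.
apply: (@iso_mono _ _ _ _ _ (assoc C a b (tunit C))).
rewrite tensm_compl compA assoc_nat -(triangle C b) tensm_compr -!compA.
rewrite [X in _ ∘ X]compA -pentagon compA -assoc_nat -compA tensm1.
by rewrite triangle.
Qed.

(** By naturality of the left unitor at itself, tensoring it with the unit on
    the left gives the left unitor of [I ⊗ I], so that [lunit_tens] and the
    triangle compare the two unitors of [I]. *)
Lemma lunit_unit : iso_hom (lunit C (tunit C)) = runit C (tunit C).
Proof.
apply: tens_unitr_faithful; rewrite -triangle -lunit_tens; congr (_ ∘ _).
by apply: (@iso_mono _ _ _ _ _ (lunit C (tunit C))); rewrite lunit_nat.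
Qed.

End UnitCoherence.

(** * Transport of the structure along a map of objects *)

(** The category on [obD] is the one for which [P] is fully faithful.  The
    structure on it is left as a parameter, subject to compatibility with [phi]
    and [eps]; these equations determine it because [phi] and [eps] are
    invertible.  Taking it as a parameter allows associators and unitors that
    are identities on the nose.  Every axiom is proved in one way: precompose
    with enough copies of [phi] and [eps], move the structure maps through them,
    and use the same axiom in [C]. *)
Section FullImage.
Variables (obC obD : Type) (C : symMonCat obC) (P : obD -> obC).

Definition full_image : category obD :=
  @Category obD (fun a b => hom C (P a) (P b)) (fun a => idm C (P a))
    (fun _ _ _ g f => g ∘ f) (fun _ _ => @comp1m _ C _ _)
    (fun _ _ => @compm1 _ C _ _) (fun _ _ _ _ => @compA _ C _ _ _ _).

Definition full_image_iso (a b : obD) (f : iso C (P a) (P b)) :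
    iso full_image a b :=
  @Iso _ full_image a b (iso_hom f) (iso_inv f) (iso_invK f) (iso_homK f).

Definition full_image_functor : functor full_image C :=
  @Functor _ _ full_image C P (fun _ _ f => f) (fun _ => erefl)
    (fun _ _ _ _ _ => erefl).

Variables (t : obD -> obD -> obD) (u : obD).
Variable phi : forall a b, iso C (tens C (P a) (P b)) (P (t a b)).
Variable eps : iso C (tunit C) (P u).

Variable tm : forall a b a' b', hom C (P a) (P a') -> hom C (P b) (P b') ->
  hom C (P (t a b)) (P (t a' b')).
Variable al : forall a b c, iso C (P (t (t a b) c)) (P (t a (t b c))).
Variable la : forall a, iso C (P (t u a)) (P a).
Variable ra : forall a, iso C (P (t a u)) (P a).
Variable br : forall a b, iso C (P (t a b)) (P (t b a)).

Hypothesis tmE : forall a b a' b' (f : hom C (P a) (P a'))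
    (g : hom C (P b) (P b')),
  tm f g ∘ phi a b = phi a' b' ∘ (f ⊗ g).
Hypothesis alE : forall a b c,
  al a b c ∘ (phi (t a b) c ∘ (phi a b ⊗ idm C (P c)))
  = phi a (t b c) ∘ ((idm C (P a) ⊗ phi b c) ∘ assoc C (P a) (P b) (P c)).
Hypothesis laE : forall a,
  la a ∘ (phi u a ∘ (eps ⊗ idm C (P a))) = lunit C (P a).
Hypothesis raE : forall a,
  ra a ∘ (phi a u ∘ (idm C (P a) ⊗ eps)) = runit C (P a).
Hypothesis brE : forall a b,
  br a b ∘ phi a b = phi b a ∘ braid C (P a) (P b).

Lemma tmEr (a b a' b' : obD) d (f : hom C (P a) (P a'))
    (g : hom C (P b) (P b')) (r : hom C d _) :
  tm f g ∘ (phi a b ∘ r) = phi a' b' ∘ ((f ⊗ g) ∘ r).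
Proof. by rewrite compA tmE -compA. Qed.

Lemma alEr (a b c : obD) d (r : hom C d _) :
  al a b c ∘ (phi (t a b) c ∘ ((phi a b ⊗ idm C (P c)) ∘ r))
  = phi a (t b c) ∘
    ((idm C (P a) ⊗ phi b c) ∘ (assoc C (P a) (P b) (P c) ∘ r)).
Proof. by have := congr1 (fun h => h ∘ r) (alE a b c); rewrite /= -!compA. Qed.

Lemma brEr (a b : obD) d (r : hom C d _) :
  br a b ∘ (phi a b ∘ r) = phi b a ∘ (braid C (P a) (P b) ∘ r).
Proof. by rewrite compA brE -compA. Qed.

Lemma phi2_epi (a b c : obD) d (g h : hom C (P (t (t a b) c)) d) :
  g ∘ (phi (t a b) c ∘ (phi a b ⊗ idm C (P c)))
  = h ∘ (phi (t a b) c ∘ (phi a b ⊗ idm C (P c))) -> g = h.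
Proof.
exact: (@iso_epi _ _ _ _ _ (comp_iso (phi (t a b) c)
                              (tens_iso (phi a b) (id_iso C (P c))))).
Qed.

Lemma tm1 (a b : obD) : tm (idm C (P a)) (idm C (P b)) = idm C (P (t a b)).
Proof.
by apply: (@iso_epi _ _ _ _ _ (phi a b)); rewrite tmE tensm1 compm1 comp1m.
Qed.

Lemma tm_comp (a b a' b' a'' b'' : obD)
    (f' : hom C (P a') (P a'')) (f : hom C (P a) (P a'))
    (g' : hom C (P b') (P b'')) (g : hom C (P b) (P b')) :
  tm (f' ∘ f) (g' ∘ g) = tm f' g' ∘ tm f g.
Proof.
apply: (@iso_epi _ _ _ _ _ (phi a b)).
by rewrite tmE tensm_comp -compA tmE tmEr.
Qed.

Lemma al_nat (a b c a' b' c' : obD) (f : hom C (P a) (P a'))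
    (g : hom C (P b) (P b')) (h : hom C (P c) (P c')) :
  al a' b' c' ∘ tm (tm f g) h = tm f (tm g h) ∘ al a b c.
Proof.
apply: phi2_epi; rewrite -!compA tmEr alE tmEr.
rewrite -tensm_comp tmE compm1 -[h in LHS]comp1m tensm_comp alEr.
by rewrite assoc_nat !tensm_compr_assoc tmE comp1m compm1.
Qed.

Lemma la_nat (a a' : obD) (f : hom C (P a) (P a')) :
  la a' ∘ tm (idm C (P u)) f = f ∘ la a.
Proof.
apply: (@iso_epi _ _ _ _ _ (comp_iso (phi u a) (tens_iso eps (id_iso C _)))).
rewrite -[LHS]compA -[RHS]compA laE [iso_hom _]/= tmEr.
rewrite -tensm_comp comp1m compm1 -lunit_nat -laE -!compA -tensm_comp.
by rewrite compm1 comp1m.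
Qed.

Lemma ra_nat (a a' : obD) (f : hom C (P a) (P a')) :
  ra a' ∘ tm f (idm C (P u)) = f ∘ ra a.
Proof.
apply: (@iso_epi _ _ _ _ _ (comp_iso (phi a u) (tens_iso (id_iso C _) eps))).
rewrite -[LHS]compA -[RHS]compA raE [iso_hom _]/= tmEr.
rewrite -tensm_comp comp1m compm1 -runit_nat -raE -!compA -tensm_comp.
by rewrite compm1 comp1m.
Qed.

Lemma br_nat (a b a' b' : obD) (f : hom C (P a) (P a'))
    (g : hom C (P b) (P b')) :
  br a' b' ∘ tm f g = tm g f ∘ br a b.
Proof.
apply: (@iso_epi _ _ _ _ _ (phi a b)).
by rewrite -!compA tmE brE brEr braid_nat tmEr.
Qed.

(** Both sides, precomposed with the three isomorphisms that merge the four
    tensor factors from the left, equal the corresponding merging from the right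
    after the respective side of the pentagon in [C]. *)
Lemma al_pentagon (a b c d : obD) :
  al a b (t c d) ∘ al (t a b) c d
  = tm (idm C (P a)) (al b c d) ∘ al a (t b c) d
    ∘ tm (al a b c) (idm C (P d)).
Proof.
apply: phi2_epi.
apply: (@iso_epi _ _ _ _ _
  (tens_iso (tens_iso (phi a b) (id_iso C (P c))) (id_iso C (P d)))).
have -> : iso_hom (tens_iso (tens_iso (phi a b) (id_iso C (P c)))
    (id_iso C (P d))) = (phi a b ⊗ idm C (P c)) ⊗ idm C (P d) by [].
transitivity (phi a (t b (t c d)) ∘ ((idm C (P a) ⊗ phi b (t c d)) ∘
  ((idm C (P a) ⊗ (idm C (P b) ⊗ phi c d)) ∘
   (assoc C (P a) (P b) (tens C (P c) (P d)) ∘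
    assoc C (tens C (P a) (P b)) (P c) (P d))))).
  rewrite -!compA alEr assoc_nat tensm1 tens_exchange alEr.
  by rewrite -[idm C (tens C (P a) (P b))]tensm1 assoc_natr.
rewrite pentagon -!compA tmEr -!tensm_compl alE !tensm_compl alEr.
by rewrite assoc_natr tmEr !tensm_compr_assoc !comp1m -!compA alE.
Qed.

Lemma al_triangle (a b : obD) :
  tm (idm C (P a)) (la b) ∘ al a u b = tm (ra a) (idm C (P b)).
Proof.
apply: phi2_epi.
apply: (@iso_epi _ _ _ _ _
  (tens_iso (tens_iso (id_iso C (P a)) eps) (id_iso C (P b)))).
have -> : iso_hom (tens_iso (tens_iso (id_iso C (P a)) eps)
    (id_iso C (P b))) = (idm C (P a) ⊗ eps) ⊗ idm C (P b) by [].
rewrite -!compA alEr assoc_nat !tmEr !tensm_compr_assoc -!tensm_comp !comp1m.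
by rewrite -!compA laE raE triangle.
Qed.

Lemma al_hexagon (a b c : obD) :
  al b c a ∘ br a (t b c) ∘ al a b c
  = tm (idm C (P b)) (br a c) ∘ al b a c ∘ tm (br a b) (idm C (P c)).
Proof.
apply: phi2_epi.
rewrite -!compA alE brEr [braid _ _ _ ∘ _]compA braid_nat -compA alEr.
rewrite [X in _ ∘ (_ ∘ X)]compA hexagon.
rewrite tmEr -tensm_compl brE tensm_compl alEr tmEr.
by rewrite tensm_compr_assoc comp1m brE tensm_compr -!compA.
Qed.

Lemma br_braidK (a b : obD) : br b a ∘ br a b = idm C (P (t a b)).
Proof.
apply: (@iso_epi _ _ _ _ _ (phi a b)).
by rewrite -compA brE brEr braidK compm1 comp1m.
Qed.

Definition full_image_smc : symMonCat obD :=
  @SymMonCat obD full_image t tm u tm1 tm_comp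
    (fun a b c => full_image_iso (al a b c)) al_nat
    (fun a => full_image_iso (la a)) la_nat
    (fun a => full_image_iso (ra a)) ra_nat
    (fun a b => full_image_iso (br a b)) br_nat
    al_pentagon al_triangle al_hexagon br_braidK.

Definition full_image_smf : symMonFunctor full_image_smc C.
Proof.
refine (@SymMonFunctor _ _ full_image_smc C full_image_functor phi eps
  _ _ _ _ brE) => *.
- by rewrite /= -tmE.
- by rewrite /= -!compA alE.
- by rewrite /= -!compA laE.
- by rewrite /= -!compA raE.
Defined.

End FullImage.

(** * Fully faithful, essentially surjective functors are equivalences *)

(** Pointwise inverses of a monoidal transformation are again natural and
    monoidal, so an isomorphism need only be checked on components. *)
Lemma mnt_isomorphic oD oE (A : symMonCat oD) (B : symMonCat oE)
    (G H : symMonFunctor A B) (m : monNatTrans G H)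
    (n : forall a, hom B (H a) (G a)) :
  (forall a, n a ∘ m a = idm B (G a)) -> (forall a, m a ∘ n a = idm B (H a)) ->
  monNatIsomorphic G H.
Proof.
move=> nm mn; pose i a : iso B (G a) (H a) := Iso (m a) (n a) (nm a) (mn a).
unshelve eexists m, (@MonNatTrans _ _ A B H G n _ _ _).
- move=> a b f; apply: (@iso_epi _ _ _ _ _ (i a)) => /=.
  by rewrite -!compA nm compm1 -mnt_nat compA nm comp1m.
- move=> a b; apply: (@iso_epi _ _ _ _ _ (tens_iso (i a) (i b))) => /=.
  by rewrite -!compA -tensm_comp !nm tensm1 compm1 -mnt_mu compA nm comp1m.
- by rewrite -(mnt_eps m) compA nm comp1m.
- by split.
Qed.

(** The inverse functor sends [c] to a chosen [r c] with [s c : F (r c) -> c],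
    and morphisms and structure maps to the unique preimages under [F] of their
    conjugates by [s].  Equations in [D] are tested after applying [F] and
    composing with [s], where the structure maps cancel against [s]
    ([pinvE], [pinv_muE], [pinv_epsE]). *)
Section Equivalence.
Variables (obC obD : Type) (C : symMonCat obC) (D : symMonCat obD).
Variable F : symMonFunctor D C.
Variable lift : forall a b, hom C (F a) (F b) -> hom D a b.
Hypothesis liftK : forall a b (f : hom C (F a) (F b)), fmap F (lift f) = f.
Hypothesis fmapK : forall a b (f : hom D a b), lift (fmap F f) = f.
Variable r : obC -> obD.
Variable s : forall c, iso C (F (r c)) c.

Lemma fmap_inj (a b : obD) (f g : hom D a b) : fmap F f = fmap F g -> f = g.
Proof. by move=> /(congr1 (@lift a b)); rewrite !fmapK. Qed.

Definition lift_iso (a b : obD) (f : iso C (F a) (F b)) : iso D a b.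
Proof.
refine (@Iso _ D a b (lift f) (lift (iso_inv f)) _ _).
- by apply: fmap_inj; rewrite fmap_comp !liftK iso_invK fmap1.
- by apply: fmap_inj; rewrite fmap_comp !liftK iso_homK fmap1.
Defined.

Definition pinv_map (a b : obC) (f : hom C a b) : hom D (r a) (r b) :=
  lift (iso_inv (s b) ∘ (f ∘ s a)).

Lemma pinvE (a b : obC) (f : hom C a b) :
  s b ∘ fmap F (pinv_map f) = f ∘ s a.
Proof. by rewrite liftK iso_homKr. Qed.

Lemma pinv_map1 (a : obC) : pinv_map (idm C a) = idm D (r a).
Proof. by rewrite /pinv_map comp1m iso_invK -fmap1 fmapK. Qed.

Lemma pinv_map_comp (a b c : obC) (g : hom C b c) (f : hom C a b) :
  pinv_map (g ∘ f) = pinv_map g ∘ pinv_map f.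
Proof.
by apply: fmap_inj; rewrite fmap_comp !liftK -!compA iso_homKr.
Qed.

Definition pinv_functor : functor C D :=
  @Functor _ _ C D r pinv_map pinv_map1 pinv_map_comp.

Definition pinv_mu (a b : obC) : iso D (tens D (r a) (r b)) (r (tens C a b)) :=
  lift_iso (comp_iso (inv_iso (s (tens C a b)))
    (comp_iso (tens_iso (s a) (s b)) (inv_iso (fmu F (r a) (r b))))).

Definition pinv_eps : iso D (tunit D) (r (tunit C)) :=
  lift_iso (comp_iso (inv_iso (s (tunit C))) (inv_iso (feps F))).

Lemma pinv_muE (a b : obC) :
  s (tens C a b) ∘ (fmap F (pinv_mu a b) ∘ fmu F (r a) (r b)) = s a ⊗ s b.
Proof. by rewrite /= liftK /= -!compA iso_invK iso_homKr compm1. Qed.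

Lemma pinv_epsE : s (tunit C) ∘ (fmap F pinv_eps ∘ feps F) = idm C (tunit C).
Proof. by rewrite /= liftK /= -!compA iso_invK iso_homKr. Qed.

Lemma fmu_nat_assoc (a b a' b' : obD) d (f : hom D a a') (g : hom D b b')
    (h : hom C d _) :
  fmap F (f ⊗ g) ∘ (fmu F a b ∘ h) = fmu F a' b' ∘ ((fmap F f ⊗ fmap F g) ∘ h).
Proof. by rewrite compA -fmu_nat -compA. Qed.

Lemma pinvEr (a b : obC) d (f : hom C a b) (h : hom C d _) :
  s b ∘ (fmap F (pinv_map f) ∘ h) = f ∘ (s a ∘ h).
Proof. by rewrite compA pinvE -compA. Qed.

Lemma pinv_muEr (a b : obC) d (h : hom C d _) :
  s (tens C a b) ∘ (fmap F (pinv_mu a b) ∘ (fmu F (r a) (r b) ∘ h))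
  = (s a ⊗ s b) ∘ h.
Proof. by rewrite -pinv_muE -!compA. Qed.

Lemma fmu_assoc_right (a b c : obD) :
  fmap F (assoc D a b c) ∘ (fmu F (tens D a b) c ∘ (fmu F a b ⊗ idm C (F c)))
  = fmu F a (tens D b c) ∘ ((idm C (F a) ⊗ fmu F b c)
      ∘ assoc C (F a) (F b) (F c)).
Proof. by have := fmu_assoc F a b c; rewrite -!compA. Qed.

Definition pinv_smf : symMonFunctor C D.
Proof.
refine (@SymMonFunctor _ _ C D pinv_functor pinv_mu pinv_eps _ _ _ _ _) => /=.
- move=> a b a' b' f g; apply: fmap_inj; rewrite !fmap_comp.
  apply: (@iso_mono _ _ _ _ _ (s _)); apply: (@iso_epi _ _ _ _ _ (fmu F _ _)).
  rewrite -!compA -fmu_nat pinv_muEr pinvEr pinv_muE.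
  by rewrite -!tensm_comp !pinvE.
- move=> a b c; apply: fmap_inj; rewrite !fmap_comp.
  apply: (@iso_mono _ _ _ _ _ (s _)); apply: (@iso_epi _ _ _ _ _ (fmu F _ _)).
  apply: (@iso_epi _ _ _ _ _ (tens_iso (fmu F _ _) (id_iso C (F _)))) => /=.
  rewrite -!compA pinvEr fmu_nat_assoc pinv_muEr -!tensm_comp fmap1 !comp1m.
  rewrite !compm1.
  rewrite pinv_muE assoc_nat fmu_assoc_right fmu_nat_assoc pinv_muEr.
  rewrite !tensm_compr_assoc fmap1 ?comp1m !compm1.
  by rewrite -!compA pinv_muE.
- move=> a; apply: fmap_inj; rewrite !fmap_comp.
  apply: (@iso_mono _ _ _ _ _ (s _)); apply: (@iso_epi _ _ _ _ _ (fmu F _ _)).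
  apply: (@iso_epi _ _ _ _ _ (tens_iso (feps F) (id_iso C (F _)))) => /=.
  rewrite -!compA pinvEr fmu_nat_assoc pinv_muEr -!tensm_comp fmap1 !comp1m.
  by rewrite compm1 pinv_epsE lunit_nat -fmu_lunit -!compA.
- move=> a; apply: fmap_inj; rewrite !fmap_comp.
  apply: (@iso_mono _ _ _ _ _ (s _)); apply: (@iso_epi _ _ _ _ _ (fmu F _ _)).
  apply: (@iso_epi _ _ _ _ _ (tens_iso (id_iso C (F _)) (feps F))) => /=.
  rewrite -!compA pinvEr fmu_nat_assoc pinv_muEr -!tensm_comp fmap1 !comp1m.
  by rewrite compm1 pinv_epsE runit_nat -fmu_runit -!compA.
- move=> a b; apply: fmap_inj; rewrite !fmap_comp.
  apply: (@iso_mono _ _ _ _ _ (s _)); apply: (@iso_epi _ _ _ _ _ (fmu F _ _)).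
  rewrite -!compA pinvEr pinv_muE fmu_braid pinv_muEr.
  by rewrite braid_nat.
Defined.

Definition pinv_counit : monNatTrans (comp_smf F pinv_smf) (id_smf C).
Proof.
refine (@MonNatTrans _ _ C C (comp_smf F pinv_smf) (id_smf C) s _ _ _) => /=.
- exact: pinvE.
- by move=> a b; rewrite pinv_muE comp1m.
- exact: pinv_epsE.
Defined.

Definition pinv_unit : monNatTrans (comp_smf pinv_smf F) (id_smf D).
Proof.
refine (@MonNatTrans _ _ D D (comp_smf pinv_smf F) (id_smf D)
  (fun a => lift (s (F a))) _ _ _) => /=.
- move=> a b f; apply: fmap_inj.
  by rewrite !fmap_comp liftK pinvE liftK.
- move=> a b; apply: fmap_inj; apply: (@iso_epi _ _ _ _ _ (fmu F _ _)).
  rewrite comp1m !fmap_comp liftK -!compA pinvEr pinv_muE.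
  by rewrite -fmu_nat !liftK.
- apply: fmap_inj; apply: (@iso_epi _ _ _ _ _ (feps F)).
  rewrite !fmap_comp liftK -!compA pinvEr pinv_epsE.
  by rewrite fmap1 compm1 comp1m.
Defined.

Lemma pinv_equivalence : smcEquivalent C D.
Proof.
exists F, pinv_smf; split.
- apply: (@mnt_isomorphic _ _ _ _ _ _ pinv_counit (fun c => iso_inv (s c))).
  + by move=> c; exact: iso_invK.
  + by move=> c; exact: iso_homK.
- apply: (@mnt_isomorphic _ _ _ _ _ _ pinv_unit
            (fun a => lift (iso_inv (s (F a))))) => a; apply: fmap_inj.
  + by rewrite fmap_comp !liftK iso_invK fmap1.
  + by rewrite fmap_comp !liftK iso_homK fmap1.
Qed.

End Equivalence.

(** The axiom of choice, in the form needed to extract data from [bijective] and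
    [isomorphic]. *)
Lemma inhabited_forall (A : Type) (B : A -> Type) :
  (forall a, inhabited (B a)) -> inhabited (forall a, B a).
Proof.
move=> inhB; constructor=> a.
by apply: proj1_sig (constructive_indefinite_description (fun=> True) _);
   case: (inhB a) => b; exists b.
Qed.

Lemma ff_eso_equivalent (obC obD : Type) (C : symMonCat obC)
    (D : symMonCat obD) (F : symMonFunctor D C) :
  (forall a b, bijective (@fmap _ _ _ _ F a b)) ->
  (forall c, exists a, isomorphic C (F a) c) ->
  smcEquivalent C D.
Proof.
move=> ff eso.
have [lift] : inhabited (forall ab,
    {g : hom C (F ab.1) (F ab.2) -> hom D ab.1 ab.2 |
    cancel (@fmap _ _ _ _ F ab.1 ab.2) g /\ cancel g (fmap F (b := ab.2))}).
  apply: inhabited_forall => -[a b].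
  by case: (ff a b) => g; constructor; exists g.
have [s] : inhabited (forall c, {a & iso C (F a) c}).
  apply: inhabited_forall => c.
  by case: (eso c) => a [f]; constructor; exists a.
apply: (@pinv_equivalence _ _ _ _ F (fun a b => sval (lift (a, b))) _ _
  (fun c => projT1 (s c)) (fun c => projT2 (s c))).
- by move=> a b; case: (lift (a, b)) => g [].
- by move=> a b; case: (lift (a, b)) => g [].
Qed.

(** * The prop of tensor powers of an object *)

Section TensorPowers.
Variables (ob : Type) (C : symMonCat ob) (x : ob).

(** Unlike [tpow], these powers end in a unit factor, so that no exponent but
    [0] is special and [rpow (m.+1 + n)] computes to [x ⊗ rpow (m + n)]. *)
Fixpoint rpow (n : nat) : ob :=
  if n is m.+1 then tens C x (rpow m) else tunit C.

Lemma rpow_tpow (n : nat) : isomorphic C (rpow n) (tpow C x n).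
Proof.
elim: n => [|[|n] IH]; first by constructor; exact: id_iso.
- by constructor; exact: runit.
- by apply: isomorphic_tens IH; constructor; exact: id_iso.
Qed.

Fixpoint rpow_add (m n : nat) :
    iso C (tens C (rpow m) (rpow n)) (rpow (m + n)) :=
  if m is k.+1 return iso C (tens C (rpow m) (rpow n)) (rpow (m + n))
  then comp_iso (tens_iso (id_iso C x) (rpow_add k n))
                (assoc C x (rpow k) (rpow n))
  else lunit C (rpow n).

(** The morphism [eq_hom] of the prop to be, as an isomorphism of [C]. *)
Definition rpow_eq (m n : nat) (e : m = n) : iso C (rpow m) (rpow n) :=
  match e in _ = k return iso C (rpow m) (rpow k) with
  | erefl => id_iso C (rpow m)
  end.

Lemma rpow_eq_id (m : nat) (e : m = m) : iso_hom (rpow_eq e) = idm C (rpow m).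
Proof. by rewrite (eq_irrelevance e erefl). Qed.

Lemma rpow_eqS (m n : nat) (e : m = n) (e' : m.+1 = n.+1) :
  iso_hom (rpow_eq e') = idm C x ⊗ rpow_eq e.
Proof. by case: _ / e e' => e'; rewrite rpow_eq_id tensm1. Qed.

(** Coherence: the identity is compatible with the two ways of merging three
    powers, hence is the associator of the prop.  The base case is [lunit_tens];
    the inductive step is the pentagon on [x] and the three powers. *)
Lemma rpow_addA (m n p : nat) (e : m + n + p = m + (n + p)) :
  rpow_eq e ∘ (rpow_add (m + n) p ∘ (rpow_add m n ⊗ idm C (rpow p)))
  = rpow_add m (n + p) ∘ ((idm C (rpow m) ⊗ rpow_add n p)
      ∘ assoc C (rpow m) (rpow n) (rpow p)).
Proof.
elim: m e => [|m IH] e /=.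
  by rewrite rpow_eq_id comp1m compA lunit_nat -compA lunit_tens.
rewrite (rpow_eqS (esym (addnA m n p))) tensm_compl -!compA assoc_natr.
rewrite !tensm_compr_assoc !comp1m -!compA IH.
rewrite -[idm C (tens C x (rpow m))]tensm1 assoc_natr pentagon -!compA.
by rewrite !tensm_compr_assoc !comp1m -!compA.
Qed.

Lemma rpow_add0n (n : nat) (e : 0 + n = n) :
  rpow_eq e ∘ (rpow_add 0 n ∘ (idm C (tunit C) ⊗ idm C (rpow n)))
  = lunit C (rpow n).
Proof. by rewrite rpow_eq_id tensm1 comp1m compm1. Qed.

(** Here [rpow_add n 0] strips a unit on the right by means of associators and
    a left unitor; it agrees with the right unitor by [lunit_unit] at [0] and by
    [runit_tens] at successors. *)
Lemma rpow_addn0 (n : nat) (e : n + 0 = n) :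
  rpow_eq e ∘ (rpow_add n 0 ∘ (idm C (rpow n) ⊗ idm C (tunit C)))
  = runit C (rpow n).
Proof.
elim: n e => [|n IH] e /=; rewrite tensm1 compm1.
  by rewrite rpow_eq_id comp1m lunit_unit.
rewrite (rpow_eqS (addn0 n)) !tensm_compr_assoc comp1m.
by rewrite -runit_tens -(IH (addn0 n)) tensm1 compm1.
Qed.

Definition power_tens (a b a' b' : nat) (f : hom C (rpow a) (rpow a'))
    (g : hom C (rpow b) (rpow b')) : hom C (rpow (a + b)) (rpow (a' + b')) :=
  rpow_add a' b' ∘ (f ⊗ g) ∘ iso_inv (rpow_add a b).

Definition power_braid (a b : nat) : iso C (rpow (a + b)) (rpow (b + a)) :=
  comp_iso (rpow_add b a)
    (comp_iso (braid C (rpow a) (rpow b)) (inv_iso (rpow_add a b))).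

Lemma power_tensE (a b a' b' : nat) (f : hom C (rpow a) (rpow a'))
    (g : hom C (rpow b) (rpow b')) :
  power_tens f g ∘ rpow_add a b = rpow_add a' b' ∘ (f ⊗ g).
Proof. by rewrite -compA iso_invK compm1. Qed.

Lemma power_braidE (a b : nat) :
  power_braid a b ∘ rpow_add a b = rpow_add b a ∘ braid C (rpow a) (rpow b).
Proof. by rewrite /= -!compA iso_invK compm1. Qed.

Definition power_smc : symMonCat nat :=
  full_image_smc power_tensE (fun a b c => rpow_addA (esym (addnA a b c)))
    (eps := id_iso C (tunit C)) (u := 0)
    (fun a => rpow_add0n (add0n a)) (fun a => rpow_addn0 (addn0 a))
    power_braidE.

Definition power_smf : symMonFunctor power_smc C :=
  full_image_smf power_tensE (fun a b c => rpow_addA (esym (addnA a b c)))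
    (eps := id_iso C (tunit C)) (u := 0)
    (fun a => rpow_add0n (add0n a)) (fun a => rpow_addn0 (addn0 a))
    power_braidE.

Lemma rpow_eq_hom (m n : nat) (e : m = n) :
  iso_hom (rpow_eq e) = eq_hom power_smc e.
Proof. by case: _ / e. Qed.

Lemma power_strict : strict power_smc.
Proof.
split.
- by exists (fun a b c => esym (addnA a b c)) => a b c; exact: rpow_eq_hom.
- by exists (fun a => add0n a) => a; exact: rpow_eq_hom.
- by exists (fun a => addn0 a) => a; exact: rpow_eq_hom.
Qed.

Definition power_prop : PROP := MkPROP power_strict (fun _ _ => erefl).

End TensorPowers.

(** * Tensor powers of the generator of a prop *)

(** Strictness gives [0 + tunit T = 0] on objects. *)
Lemma prop_tunit (T : PROP) : tunit T = 0.
Proof.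
by have [_ _ [eR _]] := prop_strict T; have := eR 0; rewrite prop_tens.
Qed.

Lemma prop_image_tpow (ob : Type) (C : symMonCat ob) (T : PROP)
    (j : symMonFunctor T C) (n : nat) :
  isomorphic C (j n) (tpow C (j 1) n).
Proof.
elim: n => [|[|n] IH]; last 1 first.
- apply: isomorphic_trans (isomorphic_tens (isomorphic_eq C erefl) IH).
  apply: isomorphic_sym; constructor; rewrite -[n.+2](prop_tens T 1 n.+1).
  exact: fmu.
- by apply: isomorphic_sym; constructor; have := feps j; rewrite prop_tunit.
- exact: isomorphic_eq.
Qed.

Theorem proposition2p2p2 (ob : Type) (C : symMonCat ob) :
  (exists T : PROP, smcEquivalent C T) <->
  (exists x : ob, forall c : ob, exists n : nat, isomorphic C c (tpow C x n)).
Proof.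
split=> [[T [j [k [[s [t [ts st]]] _]]]] | [x gen]].
- exists (j 1) => c; exists (k c).
  apply: isomorphic_trans (prop_image_tpow j (k c)).
  by constructor; exact: Iso (t c) (s c) (st c) (ts c).
- exists (power_prop C x).
  apply: (@ff_eso_equivalent _ _ _ _ (power_smf C x)) => [a b | c].
    by exists id.
  have [n cn] := gen c; exists n.
  exact: isomorphic_trans (rpow_tpow C x n) (isomorphic_sym cn).
Qed.
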